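(* Let $(V,\langle\cdot,\cdot\rangle)$ be a real inner product space and let $R:V^3\to V$ be an almost isotropic algebraic curvature tensor with associated constant $\kappa$. Then either $R=\kappa R_1$ is isotropic, or there exist a constant $\tau=\pm1$ and a nonzero skew symmetric endomorphism $A:V\to V$ such that $R=\kappa R_1+\tau R_A$.
   Context: Inner product spaces are finite-dimensional. An algebraic curvature tensor on $V$ is a (multilinear) tensor $R:V^3\to V$, $(x,y,z)\mapsto R(x,y)z$, with $\langle R(x,y)z,w\rangle=-\langle R(y,x)z,w\rangle=\langle R(z,w)x,y\rangle$ and $R(x,y)z+R(y,z)x+R(z,x)y=0$. For a unit vector $v$, the Jacobi operator $\mathcal{J}_v:v^\perp\to v^\perp$ is $\mathcal{J}_v(w)=R(w,v)v$. $R$ is almost isotropic with associated constant $\kappa\in\mathbf{R}$ if $\operatorname{rank}(\mathcal{J}_v-\kappa\operatorname{Id}_{v^\perp})\leq1$ for every unit vector $v\in V$; it is isotropic if for some constant $k$, $\mathcal{J}_v=k\operatorname{Id}_{v^\perp}$ for every unit vector $v$. Define $R_1(x,y)z=\langle y,z\rangle x-\langle x,z\rangle y$, and for a skew symmetric endomorphism $A$ of $V$, $R_A(x,y)z=2\langle x,Ay\rangle Az+\langle x,Az\rangle Ay-\langle y,Az\rangle Ax$. *)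

(* Defs.v *)
From HB Require Import structures.
From mathcomp Require Import all_boot all_order all_algebra.
From mathcomp Require Import reals.

Set Implicit Arguments.
Unset Strict Implicit.
Unset Printing Implicit Defensive.

Import Order.TTheory GRing.Theory Num.Theory.
Local Open Scope ring_scope.

(* The inner product on V is a positive definite symmetric bilinear form       *)
(* dot : {dot V for idfun}; {dot _ for theta} is hermitian with respect to     *)
(* theta, so theta = idfun is the real, symmetric case.                        *)
Record curvature_tensor (K : realType) (V : vectType K)
    (dot : {dot V for idfun}) := CurvatureTensor {
  curv :> V -> V -> V -> V;
  curv_linear1 : forall y z, linear (fun x => curv x y z);
  curv_linear2 : forall x z, linear (fun y => curv x y z);
  curv_linear3 : forall x y, linear (fun z => curv x y z);
  curv_skew : forall x y z w, dot (curv x y z) w = - dot (curv y x z) w;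
  curv_pair : forall x y z w, dot (curv x y z) w = dot (curv z w x) y;
  curv_bianchi : forall x y z, curv x y z + curv y z x + curv z x y = 0
}.

Section Curvature.
Variables (K : realType) (V : vectType K) (dot : {dot V for idfun}).

Definition unit_vector (v : V) : Prop := dot v v = 1.

Definition perp (v : V) : {vspace V} := orthov dot <[v]>%VS.

(* linfun and vsproj are total functions with default values; jacobi_linear,   *)
(* curv_perp and jacobiE below show that no default value is involved here.    *)
Definition jacobi (T : curvature_tensor dot) (v : V) : 'End(subvs_of (perp v)) :=
  linfun (fun w : subvs_of (perp v) => vsproj (perp v) (T (vsval w) v v)).

Definition almost_isotropic (T : curvature_tensor dot) (kappa : K) : Prop :=
  forall v, unit_vector v ->
    (\dim (limg (jacobi T v - kappa *: \1%VF)%R) <= 1)%N.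

Definition isotropic (T : curvature_tensor dot) : Prop :=
  exists k : K, forall v, unit_vector v -> jacobi T v = k *: \1%VF.

Definition R_1 (x y z : V) : V := dot y z *: x - dot x z *: y.

Definition skew_symmetric (A : 'End(V)) : Prop :=
  forall x y, dot (A x) y = - dot x (A y).

Definition R_ (A : 'End(V)) (x y z : V) : V :=
  2 * dot x (A y) *: A z + dot x (A z) *: A y - dot y (A z) *: A x.

Lemma jacobi_linear (T : curvature_tensor dot) (v : V) :
  linear (fun w : subvs_of (perp v) => vsproj (perp v) (T (vsval w) v v)).
Proof. by move=> a u w; rewrite linearP curv_linear1 linearP. Qed.

Lemma curv_perp (T : curvature_tensor dot) (v w : V) : T w v v \in perp v.
Proof.
have h : dot (T w v v) v = 0.
  rewrite curv_pair; apply/eqP; move/eqP: (curv_skew T v v w v).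
  by rewrite -addr_eq0 -mulr2n mulrn_eq0.
by rewrite /perp mem_orthov1; apply/eqP.
Qed.

Lemma jacobiE (T : curvature_tensor dot) (v : V) (w : subvs_of (perp v)) :
  vsval (jacobi T v w) = T (vsval w) v v.
Proof.
pose f : subvs_of (perp v) -> subvs_of (perp v) :=
  fun w => vsproj (perp v) (T (vsval w) v v).
pose fL := GRing.isLinear.Build K _ _ _ f (@jacobi_linear T v).
pose F : {linear subvs_of (perp v) -> subvs_of (perp v)} := HB.pack f fL.
have -> : jacobi T v = linfun F by [].
by rewrite lfunE /= vsprojK ?curv_perp.
Qed.

End Curvature.

(* Main.v *)
From HB Require Import structures.
Require Import Defs.
From mathcomp Require Import all_boot all_order all_algebra.
From mathcomp Require Import boolp reals.
From mathcomp Require Import ring lra.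
Local Open Scope ring_scope.
Import Order.TTheory GRing.Theory Num.Theory.

(** Write Q(v, w) = <T(w, v)v, w> for the sectional form of a curvature tensor T.
It is symmetric in v and w, quadratic in each, vanishes for v = w, and
determines T ([curv_ext], by polarization and the Bianchi identity).

Put T = R - kappa R_1. On v^perp the Jacobi operator of T is that of R minus
kappa, so almost isotropy says exactly that for every v the symmetric bilinear
form (w, x) |-> <T(w, v)v, x> has rank at most one, that is, its 2 x 2 minors
vanish ([almost_isotropic_minors]). If Q = 0 then T = 0 and R = kappa R_1.

Otherwise fix v0, w0 with c = Q(w0, v0) <> 0. Rank one at w0 gives
Q(v, w0) = l(v)^2 / c for the linear form l(v) = <T(v0, w0)w0, v>, so the minor
of the rows w0 and w at v reads
  l(v)^2 Q(v, w) = c <T(w0, v)v, w>^2.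
Hence the quadratic map v |-> T(w0, v)v vanishes on the hyperplane l = 0, and is
therefore l(v) L(v) with L linear. Cancelling l(v)^2 yields
Q(v, w) = c <L v, w>^2, first where l(v) <> 0 and then everywhere, both sides
being polynomial in v ([sectional_square]). Since Q(v, v) = 0, L is skew
([sectional_square_skew]).

On the other hand Q = 3 <A v, w>^2 for R_A. So with tau the sign of c and
A = sqrt(|c| / 3) L, the tensors T and tau R_A have the same sectional form and
are equal. *)

Set Implicit Arguments.
Unset Strict Implicit.
Unset Printing Implicit Defensive.

(** * Linear maps and inner products *)

Section LinearFunctions.
Variables (K : realType) (U V : vectType K) (f : U -> V).
Hypothesis f_lin : linear f.

Let F : {linear U -> V} := HB.pack f (GRing.isLinear.Build K U V _ f f_lin).

Lemma linear_fun_add u v : f (u + v) = f u + f v.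
Proof. exact: (linearD F). Qed.

Lemma linear_fun_scale a u : f (a *: u) = a *: f u.
Proof. exact: (linearZ_LR F). Qed.

Lemma linear_fun_lfunE u : linfun f u = f u.
Proof. exact: (lfunE F). Qed.

End LinearFunctions.

Section InnerProduct.
Variables (K : realType) (V : vectType K) (dot : {dot V for idfun}).
Implicit Types (x y z u v w : V) (T : curvature_tensor dot) (A : 'End(V)).

Lemma dotC x y : dot x y = dot y x.
Proof. by rewrite hermC expr0 mul1r. Qed.

Lemma dotDl x y z : dot (x + y) z = dot x z + dot y z.
Proof. exact: linearDl. Qed.

Lemma dotDr x y z : dot z (x + y) = dot z x + dot z y.
Proof. exact: linearDr. Qed.

Lemma dotNl x z : dot (- x) z = - dot x z.
Proof. exact: linearNl. Qed.

Lemma dotNr x z : dot z (- x) = - dot z x.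
Proof. exact: linearNr. Qed.

Lemma dotZl a x z : dot (a *: x) z = a * dot x z.
Proof. exact: linearZl_LR. Qed.

Lemma dotZr a x z : dot z (a *: x) = a * dot z x.
Proof. exact: linearZr_LR. Qed.

Lemma dot0l z : dot 0 z = 0.
Proof. exact: linear0l. Qed.

Definition dotE := (dotDl, dotDr, dotNl, dotNr, dotZl, dotZr, dot0l).

(** Nondegeneracy turns every identity between vectors below into one between
scalars, which ring arithmetic decides. *)
Lemma dot_inj x y : (forall w, dot x w = dot y w) -> x = y.
Proof.
move=> xy; apply/eqP; rewrite -subr_eq0; apply: contraT.
by move/(@neq0_dnorm_gt0 _ _ _ dot); rewrite dotDl dotNl xy subrr ltxx.
Qed.

(** * Curvature tensors and their sectional forms *)

Lemma curvD1 T x x' y z : T (x + x') y z = T x y z + T x' y z.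
Proof. exact: (linear_fun_add (curv_linear1 T y z)). Qed.

Lemma curvD2 T x y y' z : T x (y + y') z = T x y z + T x y' z.
Proof. exact: (linear_fun_add (curv_linear2 T x z)). Qed.

Lemma curvD3 T x y z z' : T x y (z + z') = T x y z + T x y z'.
Proof. exact: (linear_fun_add (curv_linear3 T x y)). Qed.

Lemma curvZ1 T a x y z : T (a *: x) y z = a *: T x y z.
Proof. exact: (linear_fun_scale (curv_linear1 T y z)). Qed.

Lemma curvZ2 T a x y z : T x (a *: y) z = a *: T x y z.
Proof. exact: (linear_fun_scale (curv_linear2 T x z)). Qed.

Lemma curvZ3 T a x y z : T x y (a *: z) = a *: T x y z.
Proof. exact: (linear_fun_scale (curv_linear3 T x y)). Qed.

Definition curvE := (curvD1, curvD2, curvD3, curvZ1, curvZ2, curvZ3).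

Lemma curv_anti T x y z : T x y z = - T y x z.
Proof. by apply: dot_inj => w; rewrite dotNl curv_skew. Qed.

Lemma curv_skew34 T x y z w : dot (T x y z) w = - dot (T x y w) z.
Proof. by rewrite curv_pair curv_skew curv_pair. Qed.

Lemma jacobi_sym T v w x : dot (T w v v) x = dot (T x v v) w.
Proof. by rewrite curv_pair curv_skew curv_skew34 opprK. Qed.

Lemma sectional_sym T v w : dot (T w v v) w = dot (T v w w) v.
Proof. by rewrite curv_skew curv_skew34 opprK. Qed.

(** Transparent, as are the two tensors after it, so that their values compute. *)
Definition curv_comb (a : K) T (b : K) T' : curvature_tensor dot.
Proof.
exists (fun x y z => a *: T x y z + b *: T' x y z).
- by move=> y z k u v /=; rewrite !curvE; apply: dot_inj => w; rewrite !dotE; ring.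
- by move=> y z k u v /=; rewrite !curvE; apply: dot_inj => w; rewrite !dotE; ring.
- by move=> y z k u v /=; rewrite !curvE; apply: dot_inj => w; rewrite !dotE; ring.
- by move=> x y z w; rewrite (curv_anti T) (curv_anti T') !dotE; ring.
- by move=> x y z w; rewrite !dotE (curv_pair T) (curv_pair T').
- move=> x y z; transitivity (a *: (T x y z + T y z x + T z x y)
    + b *: (T' x y z + T' y z x + T' z x y)).
    by apply: dot_inj => w; rewrite !dotE; ring.
  by rewrite !curv_bianchi !scaler0 addr0.
Defined.

Definition R_1_tensor : curvature_tensor dot.
Proof.
exists (R_1 dot); rewrite /R_1.
- by move=> y z b u v; apply: dot_inj => w; rewrite !dotE; ring.
- by move=> y z b u v; apply: dot_inj => w; rewrite !dotE; ring.
- by move=> y z b u v; apply: dot_inj => w; rewrite !dotE; ring.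
- by move=> x y z w; rewrite !dotE; ring.
- by move=> x y z w; rewrite !dotE (dotC z x) (dotC z y) (dotC w x) (dotC w y); ring.
- move=> x y z; apply: dot_inj => w.
  by rewrite !dotE (dotC z x) (dotC z y) (dotC y x); ring.
Defined.

Lemma skew_swap A : skew_symmetric dot A ->
  forall x y, dot x (A y) = - dot y (A x).
Proof. by move=> A_skew x y; rewrite dotC A_skew. Qed.

Definition R_A_tensor A (A_skew : skew_symmetric dot A) : curvature_tensor dot.
Proof.
pose sk := skew_swap A_skew; exists (R_ dot A); rewrite /R_.
- by move=> y z b u v; apply: dot_inj => w; rewrite ?(linearP A) /= !dotE; ring.
- by move=> y z b u v; apply: dot_inj => w; rewrite ?(linearP A) /= !dotE; ring.
- by move=> y z b u v; apply: dot_inj => w; rewrite ?(linearP A) /= !dotE; ring.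
- by move=> x y z w; rewrite !dotE (sk y x); ring.
- move=> x y z w; rewrite !dotE !A_skew.
  by rewrite (sk z x) (sk z y) (sk w x) (sk w y) (sk z w); ring.
- move=> x y z; apply: dot_inj => w.
  by rewrite !dotE (sk z x) (sk z y) (sk y x); ring.
Defined.

Lemma dot_curv_comb (a b : K) T T' x y z w :
  dot (curv_comb a T b T' x y z) w = a * dot (T x y z) w + b * dot (T' x y z) w.
Proof. by rewrite dotDl !dotZl. Qed.

(** Polarizing in w and then in v gives T(x, y)z = - T(x, z)y. With the skew
symmetry in x and y, T is invariant under cyclic permutations, so the Bianchi
identity reads 3 T(x, y)z = 0. *)
Lemma curv_eq0 T : (forall v w, dot (T w v v) w = 0) ->
  forall x y z, T x y z = 0.
Proof.
move=> sec0.
have jac0 v w : T w v v = 0.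
  apply: dot_inj => x; rewrite dotE.
  have := sec0 v (w + x); rewrite curvE !dotE !sec0 (jacobi_sym T v x w) => e; lra.
have swap x y z : T x y z = - T x z y.
  have := jac0 (y + z) x; rewrite !curvE !jac0 add0r addr0 => /eqP.
  by rewrite addr_eq0 => /eqP.
have rot x y z : T x y z = T z x y by rewrite swap curv_anti opprK.
move=> x y z; apply: dot_inj => w; rewrite dotE.
have := congr1 (dot^~ w) (curv_bianchi T x y z).
by rewrite (rot y z x) -(rot x y z) !dotE => ?; lra.
Qed.

Lemma curv_ext T T' :
    (forall v w, dot (T w v v) w = dot (T' w v v) w) ->
  forall x y z, T x y z = T' x y z.
Proof.
move=> eqTT' x y z.
have : curv_comb 1 T (-1) T' x y z = 0.
  by apply: curv_eq0 => v w; rewrite dot_curv_comb eqTT' mulN1r mul1r subrr.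
by rewrite /= scaleN1r scale1r => /eqP; rewrite subr_eq0 => /eqP.
Qed.

Lemma R_A_sectional A (A_skew : skew_symmetric dot A) v w :
  dot (R_A_tensor A_skew w v v) w = 3 * dot (A v) w ^+ 2.
Proof.
have Avv : dot v (A v) = 0 by have := A_skew v v; rewrite dotC => ?; lra.
change (dot (R_ dot A w v v) w = 3 * dot (A v) w ^+ 2).
by rewrite /R_ !dotE Avv (dotC w (A v)); ring.
Qed.

(** * Jacobi operators of rank at most one *)

(** Only the principal 2 x 2 minors of the symmetric form
(w, x) |-> <T(w, v)v, x> are listed. By homogeneity v need not be a unit
vector, which makes the condition polynomial in v. *)
Definition jacobi_minors T := forall v w x,
  dot (T w v v) w * dot (T x v v) x = dot (T w v v) x ^+ 2.

Lemma rank_le1_minors T :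
    (forall v, unit_vector dot v ->
       exists s, forall w, exists a, T w v v = a *: s) ->
  jacobi_minors T.
Proof.
move=> rank_le1 v w x.
have [->|v_neq0] := eqVneq v 0.
  have T0 y : T y 0 0 = 0 by have := curvZ2 T 0 y 0 0; rewrite !scale0r.
  by rewrite !T0 !dotE mul0r expr0n.
(* Rescaling v to a unit vector only multiplies the Jacobi operator. *)
have d_gt0 : 0 < dot v v by exact: neq0_dnorm_gt0.
set r := Num.sqrt (dot v v); have r_neq0 : r != 0 by rewrite sqrtr_eq0 -ltNge.
have r2 : r ^+ 2 = dot v v by rewrite sqr_sqrtr ?ltW.
have u1 : unit_vector dot (r^-1 *: v) by rewrite /unit_vector !dotE -r2; field.
have [s s_line] := rank_le1 _ u1.
have T_line y : exists a, T y v v = a *: s.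
  have [a aE] := s_line y; exists (r ^+ 2 * a); rewrite -scalerA -aE.
  by apply: dot_inj => z; rewrite curvZ2 curvZ3 !dotE; field.
have [a aE] := T_line w; have [b bE] := T_line x.
have := jacobi_sym T v w x; rewrite aE bE !dotE => e.
transitivity ((a * dot s x) * (b * dot s w)); first by ring.
by rewrite -e; ring.
Qed.

Lemma almost_isotropic_minors T (kappa : K) :
  almost_isotropic T kappa -> jacobi_minors (curv_comb 1 T (- kappa) R_1_tensor).
Proof.
move=> T_ai; apply: rank_le1_minors => v v1.
set T' := curv_comb _ _ _ _.
have Tvv : T v v v = 0.
  by apply: dot_inj => z; have := curv_skew T v v v z; rewrite dotE => ?; lra.
have T'vv : T' v v v = 0 by rewrite /T' /= /R_1 Tvv subrr !scaler0 addr0.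
set S := limg (jacobi T v - kappa *: \1%VF)%R.
(* The component of w along v contributes nothing, so w may be projected
   to the orthogonal complement of v, where the operator is defined. *)
have in_S w : exists2 s, s \in S & vsval s = T' w v v.
  have w_perp : w - dot w v *: v \in perp dot v.
    have e : dot (w - dot w v *: v) v = 0 by rewrite !dotE v1 mulr1 subrr.
    by rewrite mem_orthov1; apply/eqP.
  exists ((jacobi T v - kappa *: \1%VF)%R (Subvs w_perp)).
    exact: memv_img (memvf _).
  have -> : T' w v v = T' (w - dot w v *: v) v v.
    by rewrite -scaleNr curvD1 curvZ1 T'vv scaler0 addr0.
  move: w_perp; set w' := w - _ => w_perp.
  rewrite add_lfunE opp_lfunE scale_lfunE id_lfunE linearB linearZ /= jacobiE /=.
  have /eqP w'v : dot w' v == 0 by rewrite -mem_orthov1.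
  by rewrite /R_1 v1 w'v scale0r subr0 !scale1r scalerN scaleNr.
(* The default value 0 of vpick is a valid generator when S is zero. *)
have S_line : (S <= <[vpick S]>)%VS.
  have [->|S_neq0] := eqVneq S 0%VS; first exact: sub0v.
  suff /eqP -> : <[vpick S]>%VS == S by [].
  by rewrite eqEdim -memvE memv_pick dim_vline vpick0 S_neq0; apply: T_ai.
exists (vsval (vpick S)) => w.
have [s sS <-] := in_S w; have /vlineP[a ->] := subvP S_line _ sS.
by exists a; rewrite linearZ.
Qed.

(** The sectional form is c times a perfect square: its square root
v |-> <T(w0, v)v, w> / l(v) is linear in v because the numerator vanishes on the
kernel of the linear form l. *)
Lemma sectional_square T w0 v0 : jacobi_minors T ->
    dot (T v0 w0 w0) v0 != 0 ->
  exists L : 'End(V), forall v w,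
    dot (T w v v) w = dot (T v0 w0 w0) v0 * dot (L v) w ^+ 2.
Proof.
move=> T_minors; set c := dot _ v0 => c_neq0.
pose l v := dot (T v0 w0 w0) v.
have sec0 u : dot (T w0 u u) w0 = c^-1 * l u ^+ 2.
  by rewrite sectional_sym /l -T_minors -/c mulKf.
have [L L_lin P_factor] : exists2 L : V -> V, linear L &
    forall u, T w0 u u = l u *: L u.
  (* L is the quotient by l of the expansion of T(w0, v)v around
     v - (l(v) / c) v0, a vector of the kernel of l, where it vanishes. *)
  pose L v := c^-1 *: (T w0 v0 v + T w0 v v0) - (c^-1 ^+ 2 * l v) *: T w0 v0 v0.
  exists L.
    by move=> a u v; rewrite /L /l !curvE; apply: dot_inj => w; rewrite !dotE; ring.
  have P0 u : l u = 0 -> T w0 u u = 0.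
    move=> lu; apply: dot_inj => x; rewrite dotE; apply/eqP.
    by rewrite -sqrf_eq0 -T_minors sec0 lu expr0n /= mulr0 mul0r.
  move=> u; have /P0 : l (u + (- (c^-1 * l u)) *: v0) = 0.
    by rewrite /l !dotE -/c; field.
  rewrite /L; move: (l u) => t e; apply: dot_inj => x; apply/eqP.
  rewrite -subr_eq0; move: (congr1 (dot^~ x) e).
  by rewrite !curvE !dotE => <-; apply/eqP; ring.
exists (linfun L) => v w; rewrite (linear_fun_lfunE L_lin).
have sec_generic u : l u != 0 -> dot (T w u u) w = c * dot (L u) w ^+ 2.
  move=> lu; have := T_minors u w0 w; rewrite sec0 P_factor !dotE => e.
  apply: (mulfI (_ : c^-1 * l u ^+ 2 != 0)).
    by rewrite mulf_neq0 ?invr_eq0 ?expf_neq0.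
  by rewrite e; field.
have [lv|] := eqVneq (l v) 0; last exact: sec_generic.
(* When l(v) = 0, the difference of the two sides is a quadratic form in v which
   vanishes at v0, v + v0 and v - v0, hence at v by the parallelogram law. *)
have lE k : l (v + k *: v0) = k * c by rewrite /l !dotE -/c [dot _ v]lv add0r.
have LE k : L (v + k *: v0) = L v + k *: L v0.
  by rewrite (linear_fun_add L_lin) (linear_fun_scale L_lin).
have e0 := sec_generic v0 c_neq0.
have e1 := sec_generic (v + 1 *: v0); rewrite lE LE mul1r in e1.
have e2 := sec_generic (v + -1 *: v0); rewrite lE LE mulN1r oppr_eq0 in e2.
move: (e1 c_neq0) (e2 c_neq0) e0; rewrite !curvE !dotE => ? ? ?; lra.
Qed.

(** The sectional form vanishes on the diagonal, so <L v, v> = 0. *)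
Lemma sectional_square_skew T (c : K) (L : 'End(V)) : c != 0 ->
  (forall v w, dot (T w v v) w = c * dot (L v) w ^+ 2) -> skew_symmetric dot L.
Proof.
move=> c_neq0 secL.
have Lvv v : dot (L v) v = 0.
  apply/eqP; rewrite -sqrf_eq0; apply/eqP/(mulfI c_neq0).
  by rewrite -secL mulr0; have := curv_skew T v v v v => ?; lra.
move=> x y; have := Lvv (x + y).
by rewrite (linearD L) /= !dotE !Lvv (dotC (L y)) => ?; lra.
Qed.

End InnerProduct.

Theorem theorem3 (K : realType) (V : vectType K) (dot : {dot V for idfun})
    (R : curvature_tensor dot) (kappa : K) (HR : almost_isotropic R kappa) :
  ((forall x y z : V, R x y z = kappa *: R_1 dot x y z) /\ isotropic R)
  \/
  (exists (tau : K) (A : 'End(V)),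
     [/\ tau = 1 \/ tau = -1, skew_symmetric dot A, A <> 0 &
         forall x y z : V,
           R x y z = kappa *: R_1 dot x y z + tau *: R_ dot A x y z]).
Proof.
set T := curv_comb 1 R (- kappa) (R_1_tensor dot).
have RE x y z : R x y z = kappa *: R_1 dot x y z + T x y z.
  by rewrite /= scaleNr scale1r addrC subrK.
have [[v0 [w0 /eqP c_neq0]]|T_flat] :=
    pselect (exists v w, dot (T v w w) v <> 0); last first.
  have T0 : forall x y z, T x y z = 0.
    apply: curv_eq0 => v w; apply: contrapT => n; apply: T_flat.
    by exists w, v.
  left; split=> [x y z|]; first by rewrite RE T0 addr0.
  exists kappa => v v1; apply/lfunP => w; apply: val_inj.
  rewrite scale_lfunE id_lfunE linearZ /= jacobiE RE T0 addr0 /R_1 v1 scale1r.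
  have := valP w; rewrite mem_orthov1 => /eqP ->.
  by rewrite scale0r subr0.
right; have [L secL] := sectional_square (almost_isotropic_minors HR) c_neq0.
move: c_neq0 secL; rewrite -/T; set c := dot (T v0 w0 w0) v0 => c_neq0 secL.
have L_skew := sectional_square_skew c_neq0 secL.
pose tau := Num.sg c; pose s := Num.sqrt (`|c| / 3); pose A := s *: L.
have A_skew : skew_symmetric dot A.
  by move=> x y; rewrite !scale_lfunE !dotE L_skew; ring.
(* The factor 3 comes from the sectional form 3 <A v, w>^2 of R_A. *)
have s2 : tau * (3 * s ^+ 2) = c.
  rewrite sqr_sqrtr; last by rewrite divr_ge0.
  by rewrite [3 * _]mulrC divfK ?pnatr_eq0// -numEsg.
have RA : forall x y z,
    R x y z = curv_comb kappa (R_1_tensor dot) tau (R_A_tensor A_skew) x y z.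
  apply: curv_ext => v w; rewrite dot_curv_comb R_A_sectional.
  have := secL v w; rewrite dot_curv_comb -s2 scale_lfunE dotZl /= => e; lra.
exists tau, A; split=> //.
- by move: c_neq0; rewrite /tau neq_lt => /orP[/ltr0_sg|/gtr0_sg] ->; [right|left].
(* A is nonzero because c = 3 tau <A w0, v0>^2. *)
- move=> A0; case/eqP: c_neq0.
  have Awv : s * dot (L w0) v0 = 0.
    by rewrite -dotZl -scale_lfunE -/A A0 zero_lfunE dotE.
  rewrite -/c {1}/c secL -s2.
  transitivity (3 * tau * (s * dot (L w0) v0) ^+ 2); first by ring.
  by rewrite Awv expr0n mulr0.
Qed.
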